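(* It is not true in general that if $A$ generates a ring $R$ as a ring and $S_1$ multiplicatively generates $S\subset R$, then $\mathbf{lOre}(S_1,A)\Rightarrow \mathbf{lOre}(S,R)$; this fails even when $S_1$ has only one element. That is, there exist a unital ring $R$, a subset $A\subset R$ generating $R$ as a ring, and an element $D\in R$ such that, with $S_1=\{D\}$ and $S=\{1,D,D^2,\dots\}$, the predicate $\mathbf{lOre}_{S,R}(S_1,A)$ holds but $\mathbf{lOre}_{S,R}(S,R)$ does not hold.
   Context: Rings are associative and unital, not necessarily commutative. A subset $S$ of a ring $R$ is multiplicative if $1\in S$ and $S$ is closed under multiplication; $S$ is multiplicatively generated by $S_1$ if $S$ is the set of all finite products of elements of $S_1$, including the empty product $1$. For a multiplicative subset $S\subset R$ and subsets $S_0\subset S$, $A_0\subset R$, the predicate $\mathbf{lOre}(S_0,A_0)=\mathbf{lOre}_{S,R}(S_0,A_0)$ means: for all $s\in S_0$ and all $r\in A_0$ there exist $s'\in S$ and $r'\in R$ with $s'r=r's$. In particular, $\mathbf{lOre}(S,R)$ is the usual left Ore condition for $S\subset R$. *)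

(* Defs.v *)
From mathcomp Require Import all_boot all_algebra.
From mathcomp Require Import boolp classical_sets.
Set Implicit Arguments.
Unset Strict Implicit.
Unset Printing Implicit Defensive.
Import GRing.Theory.
Local Open Scope classical_set_scope.
Local Open Scope ring_scope.

Definition ring_generates (R : pzRingType) (A : set R) : Prop :=
  smallest (fun M : set R => GRing.subring_closed [in M]) A = setT.

(* The empty sequence gives the empty product 1. *)
Definition mult_generated (R : pzRingType) (S1 : set R) : set R :=
  [set x | exists2 s : seq R, (forall y, y \in s -> S1 y) &
                              x = \prod_(y <- s) y].

(* Only used with S multiplicative and S0 a subset of S; see
   [mult_generated_multiplicative] and [sub_mult_generated]. *)
Definition lOre (R : pzRingType) (S S0 A0 : set R) : Prop :=
  forall s r, S0 s -> A0 r ->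
    exists s' r', S s' /\ s' * r = r' * s.

Lemma sub_mult_generated (R : pzRingType) (S1 : set R) :
  S1 `<=` mult_generated S1.
Proof.
move=> x S1x; exists [:: x]; last by rewrite big_seq1.
by move=> y; rewrite inE => /eqP ->.
Qed.

Lemma mult_generated_multiplicative (R : pzRingType) (S1 : set R) :
  GRing.mulr_closed [in mult_generated S1].
Proof.
split; first by apply/mem_set; exists [::]; rewrite ?big_nil.
move=> x y /set_mem[s Hs ->] /set_mem[t Ht ->]; apply/mem_set.
exists (s ++ t); last by rewrite big_cat.
by move=> z; rewrite mem_cat => /orP[/Hs|/Ht].
Qed.

Lemma mult_generated1 (R : pzRingType) (D : R) :
  mult_generated [set D] = range (fun n => D ^+ n).
Proof.
apply/seteqP; split=> x.
  move=> [s Hs ->]; exists (size s) => //.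
  elim: s Hs => [|a s IH] Hs; first by rewrite big_nil expr0.
  rewrite big_cons /= exprS IH => [|y ys]; last by apply: Hs; rewrite inE ys orbT.
  by rewrite (Hs a) // inE eqxx.
move=> [n _ <-]; exists (nseq n D).
  by move=> y /nseqP[].
by rewrite big_nseq; elim: n => // n IH; rewrite exprS iterS IH.
Qed.

(* Main.v *)
(** Let [D] act on [int^3] by [e0 |-> 0], [e1 |-> e0], [e2 |-> e2], and let [A]
    be the set of matrices with zero [(2, 0)] entry.  Since [ker D] is spanned
    by [e0] and [D ^+ 2] is the projection onto [e2], every [x] in [A] satisfies
    [D ^+ 2 * x * e0 = 0], so that [D ^+ 2 * x] factors through [D].  But [A] is
    not closed under products: it generates the elementary matrix sending [e0]
    to [e2], and [D ^+ n] times that matrix does not kill [e0] for any [n]. *)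
Require Import Defs.
From mathcomp Require Import all_boot all_algebra.
From mathcomp Require Import boolp classical_sets.
Import GRing.Theory.
Local Open Scope classical_set_scope.
Local Open Scope ring_scope.

Lemma ring_generates_addM (R : pzRingType) (A : set R) :
  (forall x, exists y z w, [/\ A y, A z, A w & x = y + z * w]) ->
  ring_generates A.
Proof.
move=> HA; apply/seteqP; split=> // x _ M [[M1 MB MM] AM].
have MD y z : M y -> M z -> M (y + z).
  (* Closure is given only for [1], differences and products, so sums come from [y - (0 - z)]. *)
  have M0 : M 0 by apply/set_mem; rewrite -(subrr 1); apply: MB; exact: M1.
  move=> My Mz; rewrite -[z]opprK; apply/set_mem/MB; first exact/mem_set.
  by rewrite -sub0r; apply: MB; exact/mem_set.
have [y [z [w [Ay Az Aw ->]]]] := HA x.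
by apply: MD; [exact: AM | apply/set_mem/MM; apply/mem_set/AM].
Qed.

Definition Dmx : 'M[int]_3 := delta_mx 0 1 + delta_mx 2%:R 2%:R.

Definition Amx : set 'M[int]_3 := [set x | x 2%:R 0 = 0].

Lemma Dmx2 : Dmx ^+ 2 = delta_mx 2%:R 2%:R.
Proof.
by rewrite expr2 mulrDl !mulrDr -!mulmxE !mul_delta_mx_cond /= !mulr0n !add0r.
Qed.

Lemma Dmx_exp_delta n : Dmx ^+ n * delta_mx 2%:R 0 = delta_mx 2%:R 0.
Proof.
elim: n => [|n IH]; first by rewrite mul1r.
rewrite exprS -mulrA IH mulrDl -!mulmxE !mul_delta_mx_cond /=.
by rewrite mulr0n mulr1n add0r.
Qed.

Lemma Dmx_delta00 : Dmx * delta_mx 0 0 = 0.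
Proof. by rewrite mulrDl -!mulmxE !mul_delta_mx_cond /= !mulr0n addr0. Qed.

Lemma ring_generates_Amx : ring_generates Amx.
Proof.
apply: ring_generates_addM => x; set c := x 2%:R 0.
(* The path from [e0] to [e2] through [e1] avoids the forbidden entry: both factors lie in [Amx],
   and their product restores the entry [c] removed from [x]. *)
exists (x - c *: delta_mx 2%:R 0), (c *: delta_mx 2%:R 1), (delta_mx 1 0).
split; rewrite /Amx /= ?mxE /= ?mulr1 ?mulr0 ?subrr //.
by rewrite -scalerAl -mulmxE mul_delta_mx subrK.
Qed.

Lemma lOre_Dmx_Amx : lOre (range (fun n => Dmx ^+ n)) [set Dmx] Amx.
Proof.
move=> s x -> Ax; exists (Dmx ^+ 2).
(* [D ^+ 2 * x] keeps only row 2 of [x], whose column 0 vanishes. Right multiplication by [D] moves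
   column 0 to column 1 and fixes column 2, so the entry of column 1 is placed in column 0. *)
exists (x 2%:R 1 *: delta_mx 2%:R 0 + x 2%:R 2%:R *: delta_mx 2%:R 2%:R).
split; first by exists 2%N.
rewrite Dmx2 mulrDl -!scalerAl !mulrDr -!mulmxE !mul_delta_mx_cond /=.
rewrite !mulr0n !mulr1n addr0 add0r.
apply/matrixP=> i j; rewrite !mxE (bigD1 2%:R) //= big1 => [|k /negPf k2].
  rewrite mxE eqxx andbT addr0; case: (i == _); last by rewrite !mul0r !mulr0 addr0.
  rewrite mul1r; case: j => [[|[|[|//]]] lej] /=.
  - by rewrite !mulr0 addr0 -[RHS]Ax; congr (x _ _); apply: val_inj.
  - by rewrite mulr1 mulr0 addr0; congr (x _ _); apply: val_inj.
  - by rewrite mulr1 mulr0 add0r; congr (x _ _); apply: val_inj.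
by rewrite mxE k2 andbF mul0r.
Qed.

Lemma not_lOre_Dmx :
  ~ lOre (range (fun n => Dmx ^+ n)) (range (fun n => Dmx ^+ n)) setT.
Proof.
move=> /(_ Dmx (delta_mx 2%:R 0)) [||_ [r [[n _ <-]]]] //; first by exists 1%N.
(* Multiplying on the right by [delta_mx 0 0] kills [r * D] but leaves [delta_mx 2 0] unchanged. *)
rewrite Dmx_exp_delta => /(congr1 (fun y => y * delta_mx 0 0)).
rewrite -mulrA Dmx_delta00 mulr0 -mulmxE mul_delta_mx.
by move=> /matrixP /(_ 2%:R 0); rewrite !mxE !eqxx.
Qed.

Theorem mainTheorem1 :
  ~ (forall (R : pzRingType) (A S1 S : set R),
       ring_generates A -> S = mult_generated S1 ->
       lOre S S1 A -> lOre S S setT) /\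
  exists (R : pzRingType) (A : set R) (D : R),
    let S1 : set R := [set D] in
    let S : set R := range (fun n : nat => D ^+ n) in
    [/\ ring_generates A, S = mult_generated S1,
        lOre S S1 A & ~ lOre S S setT].
Proof.
split=> [Ore|].
  apply: not_lOre_Dmx; apply: Ore ring_generates_Amx _ lOre_Dmx_Amx.
  by rewrite mult_generated1.
exists 'M[int]_3, Amx, Dmx; split.
- exact: ring_generates_Amx.
- by rewrite mult_generated1.
- exact: lOre_Dmx_Amx.
- exact: not_lOre_Dmx.
Qed.
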